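(* Let $\phi\ge 1$ and $N\ge 1$ be integers, and suppose the nonlinear differential equation $\dot{\mathbf x}=f(\mathbf x,t)$ has polynomial-type nonlinearity with degree of nonlinearity $\phi$. Consider the reconstruction harmonic balance (RHB) method with truncation order $N$ and $M$ equally spaced collocation nodes over one period. If $M>(\phi+1)N$, then the aliasing phenomenon is eliminated: no higher-order harmonic is aliased into the retained low-order range. That is, for every integer $n$ with $N<|n|\le \phi N$ and every integer $m$, the aliased wavenumber $n-mM$ does not lie in $[-N,N]$.
   Context: RHB method: one seeks a periodic solution of $\dot{\mathbf x}=f(\mathbf x,t)$ of frequency $\omega>0$ approximated by a truncated Fourier series of order $N$, $$\mathbf x(t)=\mathbf x_0+\sum_{n=1}^N\big[\mathbf x_{2n-1}\cos(n\omega t)+\mathbf x_{2n}\sin(n\omega t)\big],$$ and samples the state and the nonlinear function at $M$ equally spaced time nodes over one period $2\pi/\omega$. Degree of nonlinearity $\phi$: substituting a truncated Fourier series of order $N$ into $f$ produces harmonics of wavenumbers in $[-\phi N,\phi N]$. The retained (low-order) harmonics are those with wavenumber in $[-N,N]$; the higher-order harmonics are those with integer wavenumber $n$ satisfying $N<|n|\le\phi N$. Rules of aliasing: if the interval $\alpha=\omega t\in[0,2\pi]$ is discretized with uniform grid spacing $h$, put $L=\pi/h$ (the ''aliasing limit'' wavenumber). A wavenumber $n$ is aliased, on the grid, to wavenumbers of the form $n_a=n-2mL$ with $m$ an integer. With $M$ equally spaced nodes over one period, $h=2\pi/M$, so $2L=M$ and $n_a=n-mM$. Aliasing is said to occur when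 some higher-order harmonic $n$ (with $N<|n|\le\phi N$) is aliased to a wavenumber in the low-order range $[-N,N]$; it is eliminated when this never happens. *)

(* Defs.v *)
From HB Require Import structures.
From mathcomp Require Import all_boot all_order all_algebra.
From mathcomp Require Import all_classical all_reals all_analysis.
(* Not imported: its notations clash with those of MathComp-Analysis. *)
From mathcomp Require mpoly.

Set Implicit Arguments.
Unset Strict Implicit.
Unset Printing Implicit Defensive.

Import Order.TTheory GRing.Theory Num.Theory.
Local Open Scope ring_scope.

(* The coefficients are x_0, ..., x_(2K); the values of c beyond index 2K are
   irrelevant.  The terms cos(n w t) and sin(n w t) carry the wavenumbers n and
   -n, so these are the functions whose harmonics have wavenumbers in [-K, K]. *)
Definition truncated_fourier (R : realType) (d : nat) (omega : R) (K : nat)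
    (c : nat -> 'cV[R]_d) (t : R) : 'cV[R]_d :=
  c 0%N + \sum_(1 <= n < K.+1)
            (cos (n%:R * omega * t) *: c (2 * n).-1%N
             + sin (n%:R * omega * t) *: c (2 * n)%N).

(* Only the dependence on the state is polynomial; the coefficients may depend
   on time (for instance through an external forcing). *)
Definition polynomial_type (R : realType) (d : nat)
    (f : 'cV[R]_d -> R -> 'cV[R]_d) : Prop :=
  exists P : R -> 'I_d -> mpoly.mpoly d R,
    forall (x : 'cV[R]_d) (t : R) (i : 'I_d),
      f x t i 0 = mpoly.meval (fun j => x j 0) (P t i).

Definition degree_of_nonlinearity (R : realType) (d : nat) (omega : R)
    (N : nat) (f : 'cV[R]_d -> R -> 'cV[R]_d) (phi : nat) : Prop :=
  forall c : nat -> 'cV[R]_d, exists y : nat -> 'cV[R]_d, forall t : R,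
    f (truncated_fourier omega N c t) t = truncated_fourier omega (phi * N)%N y t.

Definition low_order (R : realType) (N : nat) (k : R) : Prop :=
  - N%:R <= k <= N%:R.

Definition higher_order (phi N : nat) (n : int) : Prop :=
  (N < `|n|)%N && (`|n| <= phi * N)%N.

Definition collocation_node (R : realType) (omega : R) (M i : nat) : R :=
  i%:R * (2 * pi / omega / M%:R).

(* The grid lives on the phase alpha = omega t, not on t. *)
Definition grid_spacing (R : realType) (omega : R) (M : nat) : R :=
  omega * collocation_node omega M 1 - omega * collocation_node omega M 0.

Definition aliasing_limit (R : realType) (h : R) : R := pi / h.

Definition aliased_wavenumber (R : realType) (h : R) (n m : int) : R :=
  n%:~R - 2 * m%:~R * aliasing_limit h.

Definition aliasing_occurs (R : realType) (phi N : nat) (h : R) : Prop :=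
  exists n : int, higher_order phi N n /\
    exists m : int, low_order N (aliased_wavenumber h n m).

(* Main.v *)
(* On M nodes the alias of a wavenumber n is n - m M.  For m = 0 it is n itself,
   which is not retained; for m != 0 its modulus is at least
   M - |n| > (phi + 1) N - phi N = N. *)

Require Import Defs.
From mathcomp Require Import all_boot all_order all_algebra.
From mathcomp Require Import all_classical all_reals all_analysis.
From mathcomp Require Import ring zify.

Set Implicit Arguments.
Unset Strict Implicit.
Unset Printing Implicit Defensive.

Import Order.TTheory GRing.Theory Num.Theory.
Local Open Scope ring_scope.

(** The question is one of integers: a nonzero multiple of [M] is too long a shift to bring a
    wavenumber of modulus at most [phi * N] back into the retained band. [aliased_wavenumber_grid]
    transfers this to the real-valued aliases of the grid. *)

Lemma alias_outside_low_order (phi N M : nat) (n m : int) :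
  ((phi + 1) * N < M)%N -> N%:Z < `|n| -> `|n| <= phi%:Z * N%:Z ->
  ~ (- N%:Z <= n - m * M%:Z <= N%:Z).
Proof.
move=> M_large n_high n_le /andP[lo hi].
have [m0|m_neq0] := eqVneq m 0; first by move: lo hi; rewrite m0 mul0r subr0; lia.
have M_le : M%:Z <= `|m * M%:Z|.
  by rewrite normrM [`|M%:Z|]ger0_norm // ler_peMl // -gtz0_ge1 normr_gt0.
move: M_large M_le lo hi n_le; rewrite mulnDl mul1n -PoszM.
(* With both products made opaque, the contradiction is linear. *)
move: (phi * N)%N (m * M%:Z) => ? ?; lia.
Qed.

(** In phase the spacing is [2 * pi / M], free of [omega], so twice the aliasing limit is [M]. *)
Lemma aliased_wavenumber_grid (R : realType) (omega : R) (M : nat)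
    (n m : int) :
  0 < omega -> (0 < M)%N ->
  aliased_wavenumber (grid_spacing omega M) n m = (n - m * M%:Z)%:~R.
Proof.
move=> omega_gt0 M_gt0.
have omega_neq0 : omega != 0 by rewrite gt_eqF.
have M_neq0 : M%:R != 0 :> R by rewrite pnatr_eq0 -lt0n.
have pi_neq0 : pi != 0 :> R by rewrite gt_eqF // pi_gt0.
rewrite /aliased_wavenumber /aliasing_limit /grid_spacing /collocation_node.
rewrite mul0r mulr0 subr0 mul1r rmorphB rmorphM /= -pmulrn.
(* [field] would otherwise unfold [pi] into its defining choice. *)
move: (@pi R) pi_neq0 => p p_neq0.
by field; rewrite M_neq0 omega_neq0.
Qed.

Theorem theorem1 (R : realType) (d : nat) (f : 'cV[R]_d -> R -> 'cV[R]_d)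
    (omega : R) (phi N M : nat)
    (omega_gt0 : 0 < omega)
    (phi_ge1 : (1 <= phi)%N) (N_ge1 : (1 <= N)%N)
    (f_poly : polynomial_type f)
    (f_deg : degree_of_nonlinearity omega N f phi)
    (M_large : ((phi + 1) * N < M)%N) :
  ~ aliasing_occurs phi N (grid_spacing omega M)
  /\ (forall n m : int,
        N%:Z < `|n| -> `|n| <= phi%:Z * N%:Z ->
        ~ (- N%:Z <= n - m * M%:Z <= N%:Z)).
Proof.
split=> [|n m]; last exact: alias_outside_low_order.
move=> [n [/andP[n_high n_le] [m]]].
rewrite /low_order aliased_wavenumber_grid ?(leq_ltn_trans _ M_large) //.
rewrite !pmulrn -mulrNz !ler_int.
by apply: (alias_outside_low_order M_large); lia.
Qed.
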